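(* Let $\mathcal D=(V,E)$ be an arbitrary directed acyclic graph on $V=\{1,\dots,p\}$ in a parent ordering, and let $\mathbf Y_1,\dots,\mathbf Y_n$ be an i.i.d. sample from $\mathrm N_p(\mathbf 0,(L^{-1})^\top DL^{-1})$, where $(D,L)\in\Theta_{\mathcal D}$. Let $S=\frac1n\sum_{i=1}^n\mathbf Y_i\mathbf Y_i^\top$ denote the empirical covariance matrix. If the prior distribution on $(D,L)$ is $\pi^{\Theta_{\mathcal D}}_{U,\alpha}$, then the posterior distribution of $(D,L)$ given $\mathbf Y_1,\dots,\mathbf Y_n$ is $\pi^{\Theta_{\mathcal D}}_{\widetilde U,\widetilde\alpha}$, where $\widetilde U=nS+U$ and $\widetilde\alpha=(n+\alpha_1,n+\alpha_2,\dots,n+\alpha_p)$.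
   Context: Parent ordering: every directed edge $i\to j$ satisfies $i>j$. $\mathrm{pa}(i)$ is the set of parents of $i$ (excluding $i$), $pa_i=|\mathrm{pa}(i)|$. $\mathcal L_{\mathcal D}$: real lower triangular $p\times p$ matrices with unit diagonal and $L_{ij}=0$ for $i\neq j$, $i\notin\mathrm{pa}(j)$. $\Theta_{\mathcal D}$: pairs $(D,L)$ with $D$ a $p\times p$ diagonal matrix with strictly positive diagonal and $L\in\mathcal L_{\mathcal D}$. For $U$ symmetric positive definite and $\alpha\in\mathbb R^p$ with $\alpha_i>pa_i+2$ for all $i$, the DAG--Wishart distribution $\pi^{\Theta_{\mathcal D}}_{U,\alpha}$ is the probability law on $\Theta_{\mathcal D}$ with density proportional to $\exp\{-\frac12\operatorname{tr}(LD^{-1}L^\top U)\}\prod_iD_{ii}^{-\alpha_i/2}$ with respect to $\prod_idD_{ii}\prod_i\prod_{j\in\mathrm{pa}(i)}dL_{ji}$. *)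

(* Defs.v *)
From HB Require Import structures.
From mathcomp Require Import all_boot all_order all_algebra.
From mathcomp Require Import all_classical all_reals all_analysis.

Set Implicit Arguments.
Unset Strict Implicit.
Unset Printing Implicit Defensive.

Import Order.TTheory GRing.Theory Num.Theory.
Import numFieldNormedType.Exports.

Local Open Scope classical_set_scope.
Local Open Scope ring_scope.

Section measurable_matrix.
Context {d} {T : sigmaRingType d} (m n : nat).

Definition mx_cylinder : set (set 'M[T]_(m, n)) :=
  [set A | exists (i : 'I_m) (j : 'I_n) (B : set T),
     measurable B /\ A = (fun M : 'M[T]_(m, n) => M i j) @^-1` B].

Let mx_set0 : <<s mx_cylinder >> set0.
Proof. exact: sigma_algebra0. Qed.

Let mx_setC A : <<s mx_cylinder >> A -> <<s mx_cylinder >> (~` A).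
Proof. exact: sigma_algebraC. Qed.

Let mx_bigcup (F : (set 'M[T]_(m, n))^nat) :
  (forall i, <<s mx_cylinder >> (F i)) ->
  <<s mx_cylinder >> (\bigcup_i (F i)).
Proof. exact: sigma_algebra_bigcup. Qed.

HB.instance Definition _ := @isMeasurable.Build default_measure_display
  'M[T]_(m, n) <<s mx_cylinder >> mx_set0 mx_setC mx_bigcup.

Lemma measurable_mx_entry (i : 'I_m) (j : 'I_n) :
  measurable_fun [set: 'M[T]_(m, n)] (fun M : 'M[T]_(m, n) => M i j).
Proof.
move=> _ B mB; rewrite setTI; apply: sub_sigma_algebra.
by exists i, j, B.
Qed.

End measurable_matrix.

Lemma measurable_fun_mx d d' (X : measurableType d) (T : measurableType d')
    (m n : nat) (f : X -> 'M[T]_(m, n)) :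
  (forall i j, measurable_fun [set: X] (fun x => f x i j)) ->
  measurable_fun [set: X] f.
Proof.
move=> mf; apply: (@measurability _ _ _ _ setT f (@mx_cylinder _ T m n)) => //.
move=> _ [_ [i [j [B [mB ->]]]] <-].
exact: (mf i j measurableT B mB).
Qed.

Section lebesgue_cV.
Context {R : realType}.

Section step.
Context {n : nat} (mu : {sigma_finite_measure set 'cV[R]_n -> \bar R}).

Definition cV_cons (xv : measurableTypeR R * 'cV[R]_n) : 'cV[R]_n.+1 :=
  col_mx (xv.1 : R)%:M xv.2.

Let cV_unconsl (v : 'cV[R]_n.+1) : measurableTypeR R := v ord0 ord0.
Let cV_unconsr (v : 'cV[R]_n.+1) : 'cV[R]_n := dsubmx (v : 'cV[R]_(1 + n)).

Let cV_consK xv : (cV_unconsl (cV_cons xv), cV_unconsr (cV_cons xv)) = xv.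
Proof.
case: xv => x v; congr pair; last exact: col_mxKd.
rewrite /cV_unconsl /cV_cons /= (_ : ord0 = lshift n (ord0 : 'I_1)).
  by rewrite (@col_mxEu _ 1) mxE eqxx mulr1n.
exact/val_inj.
Qed.

Lemma measurable_cV_cons : measurable_fun [set: _] cV_cons.
Proof.
apply: measurable_fun_mx => i j; rewrite ord1 /cV_cons.
case: (@splitP 1 n i) => k ik.
- rewrite (_ : (fun _ => _) = fst).
    exact: measurable_fst.
  apply/funext => xv; rewrite (_ : i = lshift n k); last exact/val_inj.
  by rewrite (@col_mxEu _ 1) mxE ord1 eqxx mulr1n.
- rewrite (_ : (fun _ => _) = (fun v : 'cV[R]_n => v k ord0) \o snd).
    apply: measurableT_comp; first exact: measurable_mx_entry.
    exact: measurable_snd.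
  apply/funext => xv; rewrite (_ : i = rshift 1 k); last exact/val_inj.
  by rewrite (@col_mxEd _ 1).
Qed.

Let measurable_cV_uncons :
  measurable_fun [set: _] (fun v => (cV_unconsl v, cV_unconsr v)).
Proof.
apply/measurable_fun_pairP; split; first exact: measurable_mx_entry.
apply: measurable_fun_mx => i j /=.
rewrite /comp /cV_unconsr/=.
under eq_fun do rewrite mxE.
exact: measurable_mx_entry.
Qed.

Definition cV_cons_measure : set 'cV[R]_n.+1 -> \bar R :=
  pushforward (@lebesgue_measure R \x mu)%E cV_cons.

HB.instance Definition _ := Measure.copy cV_cons_measure
  (measure_function_pushforward__canonical__measure_function_Measure
     (@lebesgue_measure R \x mu)%E measurable_cV_cons).

Let cV_cons_measure_sigma_finite : sigma_finite setT cV_cons_measure.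
Proof.
have /sigma_finiteP[F [TF ndF Foo]] := sigma_finiteT (@lebesgue_measure R).
have /sigma_finiteP[G [TG ndG Goo]] := sigma_finiteT mu.
exists (fun k => (fun v => (cV_unconsl v, cV_unconsr v)) @^-1` (F k `*` G k)).
  rewrite -preimage_bigcup -[LHS](preimage_setT
    (fun v => (cV_unconsl v, cV_unconsr v))); congr (_ @^-1` _).
  rewrite -setXTT TF TG predeqE => -[x y]; split=> [[/= [k _ Fkx] [l _ Gly]]|].
    exists (maxn k l) => //; split.
    - by move: x Fkx; exact/subsetPset/ndF/leq_maxl.
    - by move: y Gly; exact/subsetPset/ndG/leq_maxr.
  by move=> [k _ []/= ? ?]; split; exists k.
move=> k; have [mF Flt] := Foo k; have [mG Glt] := Goo k.
have mFG : measurable (F k `*` G k) by exact: measurableX.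
split.
  by rewrite -[X in measurable X]setTI; exact: measurable_cV_uncons.
rewrite /cV_cons_measure /pushforward -comp_preimage.
rewrite (_ : _ \o _ = id) ?preimage_id; last first.
  by apply/funext => xv /=; exact: cV_consK.
by rewrite product_measure1E// lte_mul_pinfty// ge0_fin_numE.
Qed.

HB.instance Definition _ := Measure_isSigmaFinite.Build _ _ _ cV_cons_measure
  cV_cons_measure_sigma_finite.

End step.

Fixpoint lebesgue_cV (n : nat) : {sigma_finite_measure set 'cV[R]_n -> \bar R} :=
  match n with
  | 0 => @dirac _ 'cV[R]_0 0 R
  | n'.+1 => cV_cons_measure (lebesgue_cV n')
  end.

End lebesgue_cV.

Section multivariate_normal.
Context {R : realType} {p : nat}.

Definition mvnormal_pdf (m : 'cV[R]_p) (S : 'M[R]_p) (y : 'cV[R]_p) : R :=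
  (Num.sqrt ((2 * pi) ^+ p * \det S))^-1 *
  expR (- (((y - m)^T *m invmx S *m (y - m)) ord0 ord0) / 2).

Definition mvnormal (m : 'cV[R]_p) (S : 'M[R]_p) (B : set 'cV[R]_p) : \bar R :=
  \int[lebesgue_cV p]_(y in B) (mvnormal_pdf m S y)%:E.

End multivariate_normal.

Definition posdefmx {R : realType} {p : nat} (U : 'M[R]_p) : Prop :=
  U^T = U /\ forall x : 'cV[R]_p, x != 0 -> 0 < (x^T *m U *m x) ord0 ord0.

(* The arrow i -> j is [E i j]; such an [E] is automatically irreflexive and
   acyclic, so it is exactly a DAG given in a parent ordering. *)
Definition parent_ordering {p : nat} (E : rel 'I_p) : Prop :=
  forall i j : 'I_p, E i j -> (j < i)%N.

Definition pa {p : nat} (E : rel 'I_p) (i : 'I_p) : {set 'I_p} :=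
  [set j | E j i]%SET.

Section dag_wishart.
Context {R : realType} {p : nat} (E : rel 'I_p).

Definition in_LD (L : 'M[R]_p) : Prop :=
  [/\ is_trig_mx L, forall i, L i i = 1
    & forall i j, i != j -> i \notin pa E j -> L i j = 0].

Definition ThetaD : set ('M[R]_p * 'M[R]_p) :=
  [set DL | [/\ is_diag_mx DL.1, forall i, 0 < DL.1 i i & in_LD DL.2]].

(* One real coordinate for each D_ii, and one for each L_ji with j in pa(i),
   indexed by the arrow (j, i). *)
Definition dag_coord : finType :=
  ('I_p + {e : 'I_p * 'I_p | E e.1 e.2})%type.

Definition DL_of_coord (x : 'cV[R]_#|dag_coord|) : 'M[R]_p * 'M[R]_p :=
  (diag_mx (\row_i x (enum_rank (inl i : dag_coord)) ord0),
   \matrix_(j, i) if insub (j, i) is Some e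
                  then x (enum_rank (inr e : dag_coord)) ord0
                  else (j == i)%:R).

Lemma measurable_DL_of_coord : measurable_fun [set: _] DL_of_coord.
Proof.
apply/measurable_fun_pairP; split; apply: measurable_fun_mx => i j.
- have [ij|ij] := eqVneq i j.
    rewrite (_ : (fun _ => _) = fun x : 'cV[R]_#|dag_coord| =>
      x (enum_rank (inl j : dag_coord)) ord0); first exact: measurable_mx_entry.
    by apply/funext => x; rewrite /= !mxE ij eqxx mulr1n.
  rewrite (_ : (fun _ => _) = fun=> 0); first exact: measurable_cst.
  by apply/funext => x; rewrite /= !mxE (negbTE ij) mulr0n.
- case eij : (insub (i, j) : option {e : 'I_p * 'I_p | E e.1 e.2}) => [e|].
    rewrite (_ : (fun _ => _) = fun x : 'cV[R]_#|dag_coord| =>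
      x (enum_rank (inr e : dag_coord)) ord0); first exact: measurable_mx_entry.
    by apply/funext => x; rewrite /= mxE eij.
  rewrite (_ : (fun _ => _) = fun=> (i == j)%:R); first exact: measurable_cst.
  by apply/funext => x; rewrite /= mxE eij.
Qed.

(* prod_i dD_ii prod_i prod_(j in pa(i)) dL_ji; not restricted to
   D_ii > 0, the integrals below are over ThetaD. *)
Definition dag_volume : set ('M[R]_p * 'M[R]_p) -> \bar R :=
  pushforward (lebesgue_cV #|dag_coord|) DL_of_coord.

HB.instance Definition _ := Measure.copy dag_volume
  (measure_function_pushforward__canonical__measure_function_Measure
     (lebesgue_cV #|dag_coord|) measurable_DL_of_coord).

Definition dag_wishart_weight (U : 'M[R]_p) (alpha : 'I_p -> R)
    (DL : 'M[R]_p * 'M[R]_p) : R :=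
  expR (- \tr (DL.2 *m invmx DL.1 *m DL.2^T *m U) / 2) *
  \prod_(i < p) (DL.1 i i) `^ (- alpha i / 2).

Definition dag_wishart_mass (U : 'M[R]_p) (alpha : 'I_p -> R)
    (A : set ('M[R]_p * 'M[R]_p)) : \bar R :=
  \int[dag_volume]_(DL in A `&` ThetaD) (dag_wishart_weight U alpha DL)%:E.

(* Seen as a measure on pairs of matrices that is carried by ThetaD. *)
Definition dag_wishart (U : 'M[R]_p) (alpha : 'I_p -> R)
    (A : set ('M[R]_p * 'M[R]_p)) : \bar R :=
  (dag_wishart_mass U alpha A *
   ((fine (dag_wishart_mass U alpha setT))^-1)%:E)%E.

End dag_wishart.

Definition DL_covariance {R : realType} {p : nat}
    (DL : 'M[R]_p * 'M[R]_p) : 'M[R]_p :=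
  (invmx DL.2)^T *m DL.1 *m invmx DL.2.

Definition empirical_covariance {R : realType} {p n : nat}
    (y : n.-tuple 'cV[R]_p) : 'M[R]_p :=
  n%:R^-1 *: \sum_(i < n) tnth y i *m (tnth y i)^T.

Section conditional_laws.
Context {d d1 d2 : measure_display} {Omega : measurableType d}
  {T1 : measurableType d1} {T2 : measurableType d2} {R : realType}
  (P : probability Omega R).

(* Conditionally on X, the coordinates of Y are i.i.d. with law [law X];
   cylinder sets determine the joint law of (X, Y). *)
Definition iid_given {n : nat} (X : {RV P >-> T1}) (Y : {RV P >-> n.-tuple T2})
    (law : T1 -> set T2 -> \bar R) : Prop :=
  forall (A : set T1) (B : 'I_n -> set T2),
    measurable A -> (forall i, measurable (B i)) ->
    P (X @^-1` A `&` [set w | forall i, B i (tnth (Y w) i)]) =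
    (\int[P]_(w in X @^-1` A) \prod_(i < n) law (X w) (B i))%E.

(* [k] is a regular conditional distribution of X given Y. *)
Definition conditional_distribution (X : {RV P >-> T1}) (Y : {RV P >-> T2})
    (k : R.-pker T2 ~> T1) : Prop :=
  forall (A : set T1) (B : set T2), measurable A -> measurable B ->
    P (X @^-1` A `&` Y @^-1` B) = (\int[P]_(w in Y @^-1` B) k (Y w) A)%E.

End conditional_laws.

(* Main.v *)
From HB Require Import structures.
Require Import Defs.
From mathcomp Require Import all_boot all_order all_algebra.
From mathcomp Require Import all_classical all_reals all_analysis.
From mathcomp Require Import measurable_realfun.
From mathcomp Require Import ring lra.
Import Order.TTheory GRing.Theory Num.Theory.
Import numFieldNormedType.Exports.
Set Implicit Arguments.
Unset Strict Implicit.
Unset Printing Implicit Defensive.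
Local Open Scope classical_set_scope.
Local Open Scope ring_scope.

(** The posterior is computed by Bayes' formula for densities, and everything
    rests on one algebraic remark.  Write K = L D^-1 L^T for the precision
    matrix of a pair (D, L) in Theta_D.  Since det L = 1, the Gaussian density
    of an observation y is, up to a constant that involves neither y nor
    (D, L), the unnormalised DAG-Wishart weight at (D, L) with matrix y y^T and
    all shape parameters equal to 1 ([mvnormal_pdf_weight]).  Weights multiply
    by adding their parameters ([dag_wishart_weightM]), so the prior weight
    times the likelihood of y_1, ..., y_n is the weight with parameters
    U + sum_i y_i y_i^T and n + alpha: the family is conjugate.

    The analytic part is to turn this identity of densities into a statement
    about regular conditional distributions.  [bayes_formula] does it in
    general: if on rectangles the joint law of (X, Y) is given by a joint
    density whose marginal in y is positive and finite for every y, then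
    normalising that density in the first variable gives a probability kernel,
    and this kernel is the conditional law of X given Y.  Its hypothesis only
    concerns a generating pi-system, here the boxes B_1 x ... x B_n, so the
    conditional independence of the sample is used in the form in which it is
    given.

    The kernel has to be a probability for every y, not only for almost every
    y, so the mass of the updated weight must be shown to be positive and
    finite everywhere.  Both properties are inherited from the prior, whose
    mass is positive and finite because it is the law of a random variable.
    Positivity holds because all weights are positive on the same set Theta_D
    ([dag_wishart_mass_gt0]).  For finiteness
    ([dag_wishart_mass_update_lty]), adding the positive semidefinite matrix
    sum_i y_i y_i^T to U decreases the weight; the extra factor
    prod_k D_kk^(-n/2) is absorbed by half of the exponential, because
    (L^T U L)_kk is bounded away from 0 on Theta_D
    ([posdefmx_coord_bound]); and the remaining mass, with U replaced by U/2,
    is a multiple of the mass for U by the substitution D -> 2 D in the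
    Lebesgue integral. *)

(** * Densities and Bayes' formula *)

Section density.
Context d (T : measurableType d) (R : realType).
Variables (nu lam : {measure set T -> \bar R}) (m : T -> R).
Hypotheses (mm : measurable_fun setT m) (m0 : forall x, 0 <= m x).
Hypothesis lamE : forall B, measurable B -> lam B = (\int[nu]_(x in B) (m x)%:E)%E.
Import HBNNSimple.
Local Open Scope ereal_scope.

(** Both sides agree on indicators by the definition of a density, hence on
    simple functions by linearity, hence everywhere by monotone convergence. *)
Let ge0_integral_densityT (h : T -> \bar R) :
  measurable_fun setT h -> (forall x, 0 <= h x) ->
  \int[lam]_x h x = \int[nu]_x (h x * (m x)%:E).
Proof.
move=> mh h0; pose f_ := nnsfun_approx measurableT mh.
have f_cvg x : EFin \o f_^~ x @ \oo --> h x.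
  by apply: cvg_nnsfun_approx => // y _; exact: h0.
transitivity (limn (fun n => \int[lam]_x (f_ n x)%:E)).
  rewrite -monotone_convergence//.
  - by apply: eq_integral => x _; apply/esym/cvg_lim => //; exact: f_cvg.
  - by move=> n; exact/measurable_EFinP/measurable_funP.
  - by move=> n y _; rewrite lee_fin.
  - by move=> y _ i j ij; rewrite lee_fin; exact/lefP/nd_nnsfun_approx.
transitivity (limn (fun n => \int[nu]_x ((f_ n x)%:E * (m x)%:E))); last first.
  rewrite -monotone_convergence//.
  - apply: eq_integral => x _; apply/cvg_lim => //.
    by apply: cvgeZr => //; exact: f_cvg.
  - move=> n; apply: emeasurable_funM; first exact/measurable_EFinP/measurable_funP.
    exact/measurable_EFinP.
  - by move=> n y _; rewrite mule_ge0// lee_fin.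
  - move=> y _ i j ij; rewrite lee_wpmul2r ?lee_fin//.
    exact/lefP/nd_nnsfun_approx.
congr (limn _); apply/funext => n.
rewrite integralT_nnsfun sintegralE.
have mf r : measurable (f_ n @^-1` [set r]) by [].
transitivity (\int[nu]_x \sum_(r \in range (f_ n))
    (r%:E * (\1_(f_ n @^-1` [set r]) x)%:E * (m x)%:E)).
  rewrite ge0_integral_fsum//; last 2 first.
  - move=> r; apply: emeasurable_funM; last exact/measurable_EFinP.
    exact/measurable_EFinP/measurable_funM.
  - move=> r x _; rewrite mule_ge0 ?lee_fin//.
    by have := nnfun_muleindic_ge0 (f_ n) r x; rewrite -EFinM lee_fin.
  apply: eq_fsbigr => r /[!inE] -[x _ <-].
  under eq_integral do rewrite -muleA.
  rewrite ge0_integralZl//; last 3 first.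
  - apply: emeasurable_funM; last exact/measurable_EFinP.
    exact/measurable_EFinP.
  - by move=> y _; rewrite mule_ge0// lee_fin.
  - by rewrite lee_fin.
  congr (_ * _); rewrite lamE// integral_mkcond; apply: eq_integral => y _.
  rewrite patchE indicE; case: ifPn => _; first by rewrite mul1e.
  by rewrite mul0e.
apply: eq_integral => x _.
rewrite [in RHS](fimfunE (f_ n)) -fsumEFin// ge0_mule_fsuml//; last first.
  by move=> r; exact: nnfun_muleindic_ge0.
Qed.

Lemma ge0_integral_density D (h : T -> \bar R) :
  measurable D -> measurable_fun D h -> (forall x, D x -> 0 <= h x) ->
  \int[lam]_(x in D) h x = \int[nu]_(x in D) (h x * (m x)%:E).
Proof.
move=> mD mh h0; rewrite integral_mkcond ge0_integral_densityT; last 2 first.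
- exact/(measurable_restrictT _ _).1.
- by move=> x; apply: erestrict_ge0.
rewrite [RHS]integral_mkcond; apply: eq_integral => x _.
by rewrite !patchE; case: ifPn => _; rewrite ?mul0e.
Qed.

End density.

Section indefinite_integral.
Context d (T : measurableType d) (R : realType).
Variables (nu : {measure set T -> \bar R}) (g : T -> \bar R).
Hypotheses (mg : measurable_fun setT g) (g0 : forall x, (0 <= g x)%E).
Local Open Scope ereal_scope.

(** The two proofs are arguments of the function so that its measure structure
    can be inferred from the term itself. *)
Definition indefinite_integral of measurable_fun setT g & (forall x, 0 <= g x) :=
  fun A : set T => \int[nu]_(x in A) g x.

Local Notation I := (indefinite_integral mg g0).

Let I0 : I set0 = 0. Proof. exact: integral_set0. Qed.

Let I_ge0 A : 0 <= I A.
Proof. by apply: integral_ge0 => x _; exact: g0. Qed.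

Let I_sigma_additive : semi_sigma_additive I.
Proof.
move=> F mF tF mUF; apply: cvg_toP.
  apply: ereal_nondecreasing_is_cvgn => m n mn.
  by apply: lee_sum_nneg_natr => // k _ _; exact: I_ge0.
rewrite /indefinite_integral ge0_integral_bigcup//.
exact: measurable_funTS.
Qed.

HB.instance Definition _ := isMeasure.Build _ _ _ I I0 I_ge0 I_sigma_additive.

End indefinite_integral.

Section bayes.
Context d d0 d1 d2 (Omega : measurableType d) (C : measurableType d0)
  (T1 : measurableType d1) (T2 : measurableType d2) (R : realType).
Variables (mu : {sigma_finite_measure set C -> \bar R})
  (nu : {sigma_finite_measure set T2 -> \bar R})
  (phi : C -> T1) (f : C * T2 -> \bar R).
Hypotheses (mphi : measurable_fun setT phi) (mf : measurable_fun setT f).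
Hypothesis f0 : forall x, (0 <= f x)%E.
Local Open Scope ereal_scope.

Let marginal (y : T2) := \int[mu]_c f (c, y).

Hypothesis marginal_gt0 : forall y, 0 < marginal y.
Hypothesis marginal_lty : forall y, marginal y < +oo.

Let joint (A : set T1) (y : T2) := \int[mu]_(c in phi @^-1` A) f (c, y).

Let measurable_preim A : measurable A -> measurable (phi @^-1` A).
Proof. by move=> mA; rewrite -[X in measurable X]setTI; exact: mphi. Qed.

Let measurable_restr A : measurable A ->
  measurable_fun setT (fun cy => f cy * (\1_(phi @^-1` A) cy.1)%:E).
Proof.
move=> mA; apply: emeasurable_funM => //; apply/measurable_EFinP.
exact: (measurableT_comp (measurable_indic (measurable_preim mA)) measurable_fst).
Qed.

Let jointE A y : joint A y = \int[mu]_c (f (c, y) * (\1_(phi @^-1` A) c)%:E).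
Proof.
rewrite /joint integral_mkcond; apply: eq_integral => c _.
by rewrite patchE indicE; case: ifPn => _; rewrite ?mule1 ?mule0.
Qed.

Let joint_ge0 A y : 0 <= joint A y.
Proof. by apply: integral_ge0 => c _; exact: f0. Qed.

Let measurable_joint A : measurable A -> measurable_fun setT (joint A).
Proof.
move=> mA; rewrite (funext (jointE A)).
apply: (measurable_fun_fubini_tonelli_G
  (fun cy => f cy * (\1_(phi @^-1` A) cy.1)%:E)); first exact: measurable_restr.
by move=> x; rewrite mule_ge0// lee_fin.
Qed.

Let marginalE : marginal = joint setT.
Proof. by []. Qed.

Let fine_marginal y : (fine (marginal y))%:E = marginal y.
Proof. by rewrite fineK// ge0_fin_numE ?marginal_lty// ltW. Qed.

Let measurable_pair2 y : measurable_fun setT (fun c => f (c, y)).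
Proof. exact: (measurableT_comp mf). Qed.

Let normalizer_ge0 y : (0 <= (fine (marginal y))^-1)%R.
Proof. by rewrite invr_ge0 fine_ge0// ltW. Qed.

Definition bayes_law (y : T2) (A : set T1) :=
  joint A y * ((fine (marginal y))^-1)%:E.

Let posterior0 y : bayes_law y set0 = 0.
Proof. by rewrite /bayes_law /joint preimage_set0 integral_set0 mul0e. Qed.

Let posterior_ge0 y A : 0 <= bayes_law y A.
Proof. by rewrite mule_ge0// lee_fin. Qed.

Let posterior_sigma_additive y : semi_sigma_additive (bayes_law y).
Proof.
move=> F mF tF mUF.
pose m := mscale (NngNum (normalizer_ge0 y))
  (indefinite_integral mu (measurable_pair2 y) (fun c => f0 (c, y))).
have mE A : bayes_law y A = m (phi @^-1` A).
  by rewrite /bayes_law /m /mscale/= muleC.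
under eq_fun do under eq_bigr do rewrite mE.
rewrite mE preimage_bigcup.
apply: (@measure_semi_sigma_additive _ _ _ m (fun n => phi @^-1` F n)) => //.
- by move=> n; exact: measurable_preim.
- apply/trivIsetP => i j _ _ ij; rewrite -preimage_setI.
  by move/trivIsetP : tF => ->//; rewrite preimage_set0.
- by rewrite -preimage_bigcup; exact: measurable_preim.
Qed.

HB.instance Definition _ y := isMeasure.Build _ _ _ (bayes_law y)
  (posterior0 y) (@posterior_ge0 y) (@posterior_sigma_additive y).

Let measurable_posterior A : measurable A ->
  measurable_fun setT (bayes_law ^~ A).
Proof.
move=> mA; apply: emeasurable_funM; first exact: measurable_joint.
apply/measurable_EFinP.
have -> : (fun y => (fine (marginal y))^-1)%R = (fun y => fine (marginal y) `^ (-1))%R.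
  by apply/funext => y; rewrite powR_inv1// fine_ge0// ltW.
have mfine : measurable_fun setT (fine \o marginal).
  exact: (measurableT_comp (fine_measurable measurableT)
    (measurable_joint measurableT)).
exact: (measurableT_comp (@measurable_powR R (-1)) mfine).
Qed.

Definition bayes_posterior : T2 -> {measure set T1 -> \bar R} := bayes_law.

HB.instance Definition _ := isKernel.Build _ _ _ _ _
  bayes_posterior measurable_posterior.

Let posteriorT y : bayes_posterior y setT = 1.
Proof.
rewrite /bayes_posterior/= /bayes_law -marginalE -fine_marginal -EFinM divff//.
by rewrite gt_eqF// fine_gt0// marginal_gt0 marginal_lty.
Qed.

HB.instance Definition _ := Kernel_isProbability.Build _ _ _ _ _
  bayes_posterior posteriorT.

Variables (P : probability Omega R) (X : {RV P >-> T1}) (Y : {RV P >-> T2}).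
Variable G : set (set T2).
Hypotheses (mG : measurable = <<s G >>) (GI : setI_closed G) (GT : G setT).
Hypothesis rect : forall A B, measurable A -> G B ->
  P (X @^-1` A `&` Y @^-1` B) = \int[mu]_(c in phi @^-1` A) \int[nu]_(y in B) f (c, y).

Let measurable_RV d' (T' : measurableType d') (Z : {RV P >-> T'}) A :
  measurable A -> measurable (Z @^-1` A).
Proof. by move=> mA; rewrite -[X in measurable X]setTI; exact: measurable_funPT. Qed.

(* Two finite measures in B, equal on the pi-system G by Fubini-Tonelli. *)
Let rect_joint A B : measurable A -> measurable B ->
  P (X @^-1` A `&` Y @^-1` B) = \int[nu]_(y in B) joint A y.
Proof.
move=> mA mB.
pose m1 : {measure set T2 -> \bar R} :=
  measure_function_pushforward__canonical__measure_function_Measure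
    (mrestr P (measurable_RV X mA)) (@measurable_funPT _ _ _ _ Y).
pose m2 := indefinite_integral nu (measurable_joint mA) (joint_ge0 A).
have m1E D : m1 D = P (X @^-1` A `&` Y @^-1` D).
  by rewrite /m1/= /pushforward /mrestr setIC.
rewrite -m1E -[RHS]/(m2 B).
apply: (measure_unique G (fun=> setT)) => //=.
- by rewrite bigcup_const.
- move=> D GD; rewrite m1E rect//.
  have mD : measurable D by rewrite mG; exact: sub_sigma_algebra.
  rewrite /m2 /indefinite_integral.
  transitivity (\int[nu]_y \int[mu]_c
    (f (c, y) * (\1_(phi @^-1` A) c)%:E * (\1_D y)%:E)).
    rewrite -(fubini_tonelli (fun z => f z * (\1_(phi @^-1` A) z.1)%:E * (\1_D z.2)%:E)).
    + rewrite integral_mkcond; apply: eq_integral => c _.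
      rewrite patchE; case: ifPn => cA.
        rewrite [LHS]integral_mkcond; apply: eq_integral => y _.
        by rewrite patchE !indicE cA mule1; case: ifPn => _; rewrite ?mule1 ?mule0.
      by rewrite integral0_eq// => y _; rewrite !indicE (negbTE cA) mule0 mul0e.
    + apply: emeasurable_funM; first exact: measurable_restr.
      apply/measurable_EFinP.
      exact: (measurableT_comp (measurable_indic mD) measurable_snd).
    + by move=> x; rewrite !mule_ge0 ?lee_fin.
  rewrite [RHS]integral_mkcond; apply: eq_integral => y _.
  rewrite patchE; case: ifPn => yD.
    by rewrite jointE; apply: eq_integral => c _; rewrite [\1_D _]indicE yD mule1.
  by rewrite integral0_eq// => c _; rewrite [\1_D _]indicE (negbTE yD) mule0.
- move=> _; rewrite m1E; apply: (@le_lt_trans _ _ 1); last exact: ltry.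
  by apply: probability_le1; apply: measurableI; exact: measurable_RV.
Qed.

(** Writing m for the marginal density and k for the normalised joint density,
    the joint law has density m(y) k(y, A) in y, and m is the density of the law
    of Y; so integrating k(Y, A) over the event Y in B gives back the joint
    law. *)
Theorem bayes_formula : exists2 k : R.-pker T2 ~> T1,
  forall y A, k y A = \int[mu]_(c in phi @^-1` A) f (c, y) *
                      ((fine (\int[mu]_c f (c, y)))^-1)%:E
  & conditional_distribution X Y k.
Proof.
exists (bayes_posterior : R.-pker T2 ~> T1) => //.
move=> A B mA mB; rewrite rect_joint//.
have mpost := measurable_funTS (D := B) (measurable_posterior mA).
transitivity (\int[distribution P Y]_(y in B) bayes_law y A); last first.
  by rewrite ge0_integral_pushforward.
have mfine : measurable_fun setT (fine \o marginal).
  exact: (measurableT_comp (fine_measurable measurableT)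
    (measurable_joint measurableT)).
rewrite (ge0_integral_density (nu := nu) (lam := distribution P Y) mfine)//.
- apply: eq_integral => y _ /=.
  rewrite /bayes_law -muleA -EFinM mulVf ?mule1// gt_eqF//.
  by rewrite fine_gt0// marginal_gt0 marginal_lty.
- by move=> y /=; rewrite fine_ge0// ltW.
- move=> D mD; under eq_integral do rewrite /= fine_marginal.
  by rewrite marginalE -rect_joint// preimage_setT setTI.
Qed.

End bayes.

(** A constant common to a joint density and its marginal cancels in the
    posterior. *)
Lemma ratio_scale (R : realType) (c : R) (a b : \bar R) : 0 < c ->
  b \is a fin_num ->
  (c%:E * a * ((fine (c%:E * b))^-1)%:E = a * ((fine b)^-1)%:E)%E.
Proof.
move=> c0 bfin; rewrite fineM//= invfM EFinM muleACA -EFinM divff ?mul1e//.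
by rewrite gt_eqF.
Qed.

(** * Powers of a measure and boxes of tuples *)

Section power_measure.
Context d (T : measurableType d) (R : realType).
Variable mu : {sigma_finite_measure set T -> \bar R}.
Local Open Scope ereal_scope.

Definition tuple_cons n (xv : T * n.-tuple T) : n.+1.-tuple T :=
  [tuple of xv.1 :: xv.2].

Let tuple_uncons n (v : n.+1.-tuple T) := (thead v, [tuple of behead v]).

Let tuple_consK n : cancel (@tuple_cons n) (@tuple_uncons n).
Proof.
move=> [x v]; rewrite /tuple_uncons theadE; congr pair.
exact/val_inj.
Qed.

Lemma measurable_tuple_cons n : measurable_fun setT (@tuple_cons n).
Proof. exact: measurable_cons measurable_fst measurable_snd. Qed.

Let measurable_tuple_uncons n : measurable_fun setT (@tuple_uncons n).
Proof.
apply/measurable_fun_pairP; split; last exact: measurable_behead.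
exact: measurable_tnth.
Qed.

Section step.
Variables (n : nat) (nu : {sigma_finite_measure set n.-tuple T -> \bar R}).

Definition tuple_cons_measure : set (n.+1.-tuple T) -> \bar R :=
  pushforward (mu \x nu) (@tuple_cons n).

HB.instance Definition _ := Measure.copy tuple_cons_measure
  (measure_function_pushforward__canonical__measure_function_Measure
     (mu \x nu) (@measurable_tuple_cons n)).

Let tuple_cons_measure_sigma_finite : sigma_finite setT tuple_cons_measure.
Proof.
have /sigma_finiteP[F [TF ndF Foo]] := sigma_finiteT mu.
have /sigma_finiteP[G [TG ndG Goo]] := sigma_finiteT nu.
exists (fun k => @tuple_uncons n @^-1` (F k `*` G k)).
  rewrite -preimage_bigcup -[LHS](preimage_setT (@tuple_uncons n)).
  congr (_ @^-1` _); rewrite -setXTT TF TG predeqE => -[x y].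
  split=> [[/= [k _ Fkx] [l _ Gly]]|[k _ [/= Fkx Gky]]]; last by split; exists k.
  exists (maxn k l) => //; split.
  - by move: x Fkx; exact/subsetPset/ndF/leq_maxl.
  - by move: y Gly; exact/subsetPset/ndG/leq_maxr.
move=> k; have [mF Flt] := Foo k; have [mG Glt] := Goo k.
split.
  rewrite -[X in measurable X]setTI; apply: measurable_tuple_uncons => //.
  exact: measurableX.
rewrite /tuple_cons_measure /pushforward -comp_preimage.
rewrite (_ : _ \o _ = id) ?preimage_id; last first.
  by apply/funext => xv /=; rewrite tuple_consK.
by rewrite product_measure1E// lte_mul_pinfty// ge0_fin_numE.
Qed.

HB.instance Definition _ := Measure_isSigmaFinite.Build _ _ _ tuple_cons_measure
  tuple_cons_measure_sigma_finite.

End step.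

(** The n-fold product of mu on n-tuples, which dominates the joint law of a
    sample of size n. *)
Fixpoint power_measure n : {sigma_finite_measure set n.-tuple T -> \bar R} :=
  match n with
  | 0 => @dirac _ (0.-tuple T) [tuple] R
  | n'.+1 => tuple_cons_measure (power_measure n')
  end.

Lemma ge0_integral_power_measure_prod n (h : 'I_n -> T -> \bar R) :
  (forall i, measurable_fun setT (h i)) -> (forall i x, 0 <= h i x) ->
  \int[power_measure n]_y \prod_(i < n) h i (tnth y i) = \prod_(i < n) \int[mu]_x h i x.
Proof.
have mprod m (g : 'I_m -> T -> \bar R) : (forall i, measurable_fun setT (g i)) ->
    measurable_fun setT (fun y : m.-tuple T => \prod_(i < m) g i (tnth y i)).
  move=> mg; have : forall s : seq 'I_m, measurable_fun setT
      (fun y : m.-tuple T => \prod_(i <- s) g i (tnth y i)).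
    elim => [|i s ih]; first by under eq_fun do rewrite big_nil; exact: measurable_cst.
    under eq_fun do rewrite big_cons; apply: emeasurable_funM => //.
    exact: (measurableT_comp (mg i) (@measurable_tnth _ _ _ i)).
  exact.
have prod0 m (g : 'I_m -> T -> \bar R) (y : m.-tuple T) : (forall i x, 0 <= g i x) ->
    0 <= \prod_(i < m) g i (tnth y i).
  by move=> g0; apply: prode_ge0 => i _.
elim: n h => [|n ih] h mh h0.
  rewrite [RHS]big_ord0 /= integral_dirac//; last exact: mprod.
  by rewrite big_ord0 diracT mule1.
rewrite [LHS]ge0_integral_pushforward//; last 3 first.
- exact: measurable_tuple_cons.
- exact: mprod.
- by move=> y _; exact: prod0.
rewrite preimage_setT.
have E xv : (\prod_(i < n.+1) h i (tnth (tuple_cons xv) i)) =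
    h ord0 xv.1 * \prod_(i < n) h (lift ord0 i) (tnth xv.2 i).
  rewrite big_ord_recl; congr (_ * _); apply: eq_bigr => i _.
  by rewrite tnthS; congr (h _ (tnth _ _)); exact/val_inj.
under eq_integral do rewrite /= E.
rewrite fubini_tonelli1/=; last 2 first.
- apply: emeasurable_funM; first exact: (measurableT_comp (mh ord0) measurable_fst).
  exact: (measurableT_comp
    (mprod n (fun i => h (lift ord0 i)) (fun i => mh _)) measurable_snd).
- by move=> xv; rewrite mule_ge0// (prod0 n (fun i => h (lift ord0 i))).
rewrite big_ord_recl -ih// -ge0_integralZr//; last first.
  by apply: integral_ge0 => y _; exact: (prod0 n (fun i => h (lift ord0 i))).
apply: eq_integral => x _; rewrite /fubini_F/= ge0_integralZl//.
- exact: (mprod n (fun i => h (lift ord0 i))).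
- by move=> y _; exact: (prod0 n (fun i => h (lift ord0 i))).
Qed.

End power_measure.

Section box.
Context d (T : measurableType d) (n : nat).

Definition box (B : 'I_n -> set T) : set (n.-tuple T) :=
  [set y | forall i, B i (tnth y i)].

Definition measurable_boxes : set (set (n.-tuple T)) :=
  [set box B | B in [set B : 'I_n -> set T | forall i, measurable (B i)]].

Lemma setI_closed_boxes : setI_closed measurable_boxes.
Proof.
move=> _ _ [B mB <-] [B' mB' <-]; exists (fun i => B i `&` B' i).
  by move=> i; exact: measurableI.
apply/seteqP; split => [y yBB'|y [yB yB'] i]; last by split.
by split=> i; have [] := yBB' i.
Qed.

Lemma measurable_boxesT : measurable_boxes setT.
Proof.
exists (fun=> setT); first by move=> i; exact: measurableT.
by apply/seteqP; split.
Qed.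

Lemma measurable_box (B : 'I_n -> set T) :
  (forall i, measurable (B i)) -> measurable (box B).
Proof.
move=> mB; have -> : box B = \bigcap_(i in [set` 'I_n]) (fun y => tnth y i) @^-1` B i.
  by apply/seteqP; split => [y yB i _|y yB i]; exact: yB.
apply: fin_bigcap_measurable => // i _.
by rewrite -[X in measurable X]setTI; exact: measurable_tnth.
Qed.

Lemma measurable_tupleE : (@measurable _ (n.-tuple T)) = <<s measurable_boxes >>.
Proof.
apply/seteqP; split; last first.
  apply: smallest_sub; first exact: sigma_algebra_measurable.
  by move=> _ [B mB <-]; exact: measurable_box.
apply: smallest_sub; first exact: smallest_sigma_algebra.
move=> A; rewrite -bigcup_seq => -[i _ [B mB <-]].
apply: sub_sigma_algebra; exists (fun j => if j == i then B else setT).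
  by move=> j; case: ifP.
apply/seteqP; split => [y /(_ i)|y]; first by rewrite eqxx.
by move=> -[_ By] j; case: eqP => // ->.
Qed.

End box.

(** * Scaling of Lebesgue measure *)

Section lebesgue_scaling.
Context {R : realType}.
Local Open Scope ereal_scope.

Lemma lebesgue_measure_scale (c : R) (A : set R) : (0 < c)%R -> measurable A ->
  lebesgue_measure (( *%R c) @^-1` A) = (c^-1)%:E * lebesgue_measure A.
Proof.
move=> c0 mA; have cge0 : (0 <= c)%R by exact: ltW.
have mc : measurable_fun setT ( *%R c : measurableTypeR R -> measurableTypeR R).
  exact: measurable_funM.
pose m : {measure set (measurableTypeR R) -> \bar R} :=
  mscale (NngNum cge0)
    (measure_function_pushforward__canonical__measure_function_Measure
      (@lebesgue_measure R) mc).
suff -> : lebesgue_measure A = m A.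
  by rewrite /m/= /mscale/= /pushforward muleA -EFinM mulVf ?mul1e// gt_eqF.
apply: lebesgue_measure_unique => // _ [[a b] _ <-].
rewrite /m/= /mscale/= /pushforward.
have -> : ( *%R c) @^-1` [set` `]a, b]] = [set` `](c^-1 * a)%R, (c^-1 * b)%R]].
  by apply/seteqP; split => x /=; rewrite !in_itv/= ltr_pdivrMl// ler_pdivlMl.
rewrite !lebesgue_measure_itv/= !lte_fin ltr_pM2l ?invr_gt0//.
case: ifPn => _; last by rewrite mule0.
by rewrite -!EFinB -EFinM -mulrBr mulrA divff ?mul1r// gt_eqF.
Qed.

Lemma ge0_integral_lebesgue_scale (c : R) (f : R -> \bar R) : (0 < c)%R ->
  measurable_fun setT f -> (forall x, 0 <= f x) ->
  \int[lebesgue_measure]_x f (c * x)%R = (c^-1)%:E * \int[lebesgue_measure]_x f x.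
Proof.
move=> c0 mf f0; have ic0 : (0 <= c^-1)%R by rewrite invr_ge0 ltW.
have mc : measurable_fun setT ( *%R c : measurableTypeR R -> measurableTypeR R).
  exact: measurable_funM.
transitivity (\int[pushforward (@lebesgue_measure R)
    ( *%R c : measurableTypeR R -> measurableTypeR R)]_x f x).
  by rewrite ge0_integral_pushforward.
rewrite -(ge0_integral_mscale _ measurableT (NngNum ic0))//.
apply: eq_measure_integral => A mA _.
exact: (lebesgue_measure_scale c0 mA).
Qed.

Lemma ge0_integral_lebesgue_cVS n (f : 'cV[R]_n.+1 -> \bar R) :
  measurable_fun setT f -> (forall x, 0 <= f x) ->
  \int[lebesgue_cV n.+1]_x f x =
  \int[lebesgue_measure]_t \int[lebesgue_cV n]_v f (cV_cons (t, v)).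
Proof.
move=> mf f0; rewrite [LHS]ge0_integral_pushforward//; last exact: measurable_cV_cons.
rewrite preimage_setT fubini_tonelli1//.
  exact: (measurableT_comp mf measurable_cV_cons).
by move=> xv; exact: f0.
Qed.

(** Change of variables for a diagonal linear map, one coordinate at a time. *)
Lemma ge0_integral_lebesgue_cV_scale n (c : 'I_n -> R) (f : 'cV[R]_n -> \bar R) :
  (forall i, 0 < c i)%R -> measurable_fun setT f -> (forall x, 0 <= f x) ->
  \int[lebesgue_cV n]_x f (\col_i (c i * x i ord0)%R) =
  ((\prod_(i < n) c i)^-1)%:E * \int[lebesgue_cV n]_x f x.
Proof.
have mscal m (b : 'I_m -> R) :
    measurable_fun setT (fun x : 'cV[R]_m => \col_i (b i * x i ord0)%R).
  apply: measurable_fun_mx => i j; under eq_fun do rewrite mxE.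
  by apply: measurable_funM => //; exact: measurable_mx_entry.
elim: n c f => [|n ih] c f c0 mf f0.
  rewrite big_ord0 invr1 mul1e; apply: eq_integral => x _.
  by congr f; apply/colP => -[].
rewrite ge0_integral_lebesgue_cVS//; last first.
  exact: (measurableT_comp mf (mscal _ c)).
have E t (v : 'cV[R]_n) : \col_i (c i * (cV_cons (t, v)) i ord0)%R =
    cV_cons (c ord0 * t, \col_i (c (lift ord0 i) * v i ord0))%R.
  apply/colP => i; rewrite !mxE /=.
  case: (@splitP 1 n i) => k ik; rewrite !mxE.
    rewrite ord1 eqxx !mulr1n; congr (c _ * _)%R; apply/val_inj.
    by rewrite /= ik ord1.
  by congr (c _ * _)%R; exact/val_inj.
under eq_integral do under eq_integral do rewrite E.
have mfc t : measurable_fun setT (fun v => f (cV_cons (t, v))).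
  apply: (measurableT_comp mf); apply: (measurableT_comp measurable_cV_cons).
  exact: pair1_measurable.
pose F (t : R) := \int[lebesgue_cV n]_v f (cV_cons (t, v)).
have mF : measurable_fun setT F.
  apply: (measurable_fun_fubini_tonelli_F (f \o cV_cons)).
    exact: (measurableT_comp mf measurable_cV_cons).
  by move=> xv; exact: f0.
have F0 t : 0 <= F t by exact: integral_ge0.
transitivity (\int[lebesgue_measure]_t
    (((\prod_(i < n) c (lift ord0 i))^-1)%:E * F (c ord0 * t)%R)).
  apply: eq_integral => t _.
  by rewrite (ih (fun i => c (lift ord0 i)) (fun v => f (cV_cons (c ord0 * t, v)%R))).
transitivity (((\prod_(i < n) c (lift ord0 i))^-1)%:E *
    \int[lebesgue_measure]_t F (c ord0 * t)%R).
  apply: ge0_integralZl => //.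
  - apply: (measurableT_comp mF); exact: measurable_funM.
  - by rewrite lee_fin invr_ge0 prodr_ge0// => i _; exact/ltW.
rewrite (ge0_integral_lebesgue_scale (c0 ord0) mF)//.
rewrite /F -ge0_integral_lebesgue_cVS// muleA -EFinM; congr (_%:E * _).
by rewrite big_ord_recl invfM mulrC.
Qed.

End lebesgue_scaling.

(** * Positive definite matrices *)

Section matrix_algebra.
Context {R : realType} {p : nat}.
Implicit Types (D L U V : 'M[R]_p).

Lemma invmx_eq D L : D *m L = 1%:M -> invmx D = L.
Proof.
move=> DL; have [uD _] := mulmx1_unit DL.
by rewrite -[LHS]mulmx1 -DL mulmxA mulVmx// mul1mx.
Qed.

Lemma mxtrace_scalar (M : 'M[R]_1) : \tr M = M ord0 ord0.
Proof. by rewrite /mxtrace big_ord1. Qed.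

Lemma posdefmx_unit U : posdefmx U -> U \in unitmx.
Proof.
move=> [_ posU]; rewrite unitmxE unitfE; apply/det0P => -[v v0 vU].
have /posU : v^T != 0.
  by apply: contra v0 => /eqP vT0; rewrite -[v]trmxK vT0 trmx0.
by rewrite trmxK vU mul0mx mxE ltxx.
Qed.

Lemma posdefmx_ge0 U (x : 'cV[R]_p) : posdefmx U ->
  0 <= (x^T *m U *m x) ord0 ord0.
Proof.
move=> [_ posU]; have [->|/posU/ltW//] := eqVneq x 0.
by rewrite mulmx0 mxE.
Qed.

(** The bound c is 1 / (U^-1)_kk, the minimum of the quadratic form of U over
    the affine hyperplane x_k = 1.  It is reached at w / w_k, where w is the
    k-th column of U^-1; expanding the form at x - w / w_k, where it is
    nonnegative, gives the inequality. *)
Lemma posdefmx_coord_bound U (k : 'I_p) : posdefmx U ->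
  exists2 c : R, 0 < c &
    forall x : 'cV[R]_p, x k ord0 = 1 -> c <= (x^T *m U *m x) ord0 ord0.
Proof.
move=> posU; have [Usym Upos] := posU; have uU := posdefmx_unit posU.
pose e : 'cV[R]_p := delta_mx k ord0.
pose w := invmx U *m e.
have Uw : U *m w = e by rewrite mulmxA mulmxV// mul1mx.
have dot_e (v : 'cV[R]_p) : (v^T *m e) ord0 ord0 = v k ord0.
  by rewrite -colE !mxE.
have w0 : w != 0.
  apply/eqP => w0; have : e k ord0 = 0 by rewrite -Uw w0 mulmx0 mxE.
  by rewrite mxE !eqxx => /eqP; rewrite oner_eq0.
have := Upos w w0; rewrite -mulmxA Uw dot_e; set t : R := w k ord0 => t0.
exists t^-1; first by rewrite invr_gt0.
move=> x xk.
have := posdefmx_ge0 (x - t^-1 *: w) posU.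
have xUw : (x^T *m U *m w) ord0 ord0 = 1 by rewrite -mulmxA Uw dot_e.
have wUx : (w^T *m U *m x) ord0 ord0 = 1.
  by rewrite -{1}Usym -trmx_mul Uw -[_ *m _]trmxK trmx_mul trmxK mxE dot_e.
have wUw : (w^T *m U *m w) ord0 ord0 = t by rewrite -mulmxA Uw dot_e.
have -> : (x - t^-1 *: w)^T = x^T - t^-1 *: w^T by apply/matrixP => i j; rewrite !mxE.
rewrite !mulmxBl !mulmxBr -?scalemxAl -?scalemxAr.
have entryE (A B C D : 'M[R]_1) (a : R) :
    (A - a *: B - (a *: C - a *: (a *: D))) ord0 ord0 = A ord0 ord0 -
    a * B ord0 ord0 - (a * C ord0 ord0 - a * (a * D ord0 ord0)) by rewrite !mxE.
rewrite entryE xUw wUx wUw.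
have tt : t^-1 * t = 1 by rewrite mulVf// gt_eqF.
by rewrite tt; lra.
Qed.

End matrix_algebra.

(** * Algebra of DAG-Wishart weights *)

Section weight.
Context {R : realType} {p : nat} (E : rel 'I_p).
Implicit Types (U V : 'M[R]_p) (a b : 'I_p -> R) (DL : 'M[R]_p * 'M[R]_p).

Lemma invmx_pos_diag (D : 'M[R]_p) : is_diag_mx D -> (forall i, 0 < D i i) ->
  invmx D = diag_mx (\row_i (D i i)^-1).
Proof.
move=> /diag_mxP[d ->] d0; apply: invmx_eq.
rewrite mulmx_diag; apply/matrixP => i j; rewrite !mxE.
have := d0 i; rewrite !mxE eqxx mulr1n => di0.
by rewrite mulfV// gt_eqF.
Qed.

Lemma mxtrace_quadratic_form (D L V : 'M[R]_p) :
  is_diag_mx D -> (forall i, 0 < D i i) ->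
  \tr (L *m invmx D *m L^T *m V) = \sum_k (D k k)^-1 * (L^T *m V *m L) k k.
Proof.
move=> Ddiag D0; rewrite -!mulmxA mxtrace_mulC -!mulmxA mulmxA invmx_pos_diag//.
rewrite -mulmxA /mxtrace; apply: eq_bigr => k _.
by rewrite mul_diag_mx mxE mxE.
Qed.

(** A form of the weight, valid on Theta_D, in which the inverse matrix has
    become a power of each diagonal entry, so that measurability is plain. *)
Definition diag_weight U a DL : R :=
  expR (- (\sum_k DL.1 k k `^ (-1) * (DL.2^T *m U *m DL.2) k k) / 2) *
  \prod_(i < p) DL.1 i i `^ (- a i / 2).

Lemma dag_wishart_weightE U a DL : ThetaD E DL ->
  dag_wishart_weight U a DL = diag_weight U a DL.
Proof.
move=> [Ddiag D0 _]; rewrite /dag_wishart_weight /diag_weight.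
rewrite mxtrace_quadratic_form//.
by under [in RHS]eq_bigr => k _ do rewrite powR_inv1 ?(ltW (D0 k))//.
Qed.

(** Conjugacy: the exponent is linear in U, and the powers of D_ii add up. *)
Lemma dag_wishart_weightM U V a b DL : ThetaD E DL ->
  dag_wishart_weight U a DL * dag_wishart_weight V b DL =
  dag_wishart_weight (U + V) (fun i => a i + b i) DL.
Proof.
move=> [_ D0 _]; rewrite /dag_wishart_weight mulrACA -expRD -big_split/=.
congr (expR _ * _).
  by rewrite mulmxDr linearD/= opprD mulrDl.
apply: eq_bigr => i _; rewrite -powRD; first by rewrite -mulrDl opprD.
by apply/implyP => _; rewrite gt_eqF.
Qed.

Lemma dag_wishart_weight_gt0 U a DL : ThetaD E DL -> 0 < dag_wishart_weight U a DL.
Proof.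
move=> [_ D0 _]; rewrite mulr_gt0 ?expR_gt0// prodr_gt0// => i _.
exact: powR_gt0.
Qed.

Lemma diag_weight_ge0 U a DL : 0 <= diag_weight U a DL.
Proof.
by rewrite mulr_ge0 ?expR_ge0// prodr_ge0// => i _; exact: powR_ge0.
Qed.

Lemma dag_wishart_weight0 DL : dag_wishart_weight 0 (fun=> 0) DL = 1.
Proof.
rewrite /dag_wishart_weight mulmx0 mxtrace0 oppr0 mul0r expR0 mul1r big1// => i _.
by rewrite ?oppr0 ?mul0r powRr0.
Qed.

Lemma dag_wishart_weight_sum n (V : 'I_n -> 'M[R]_p) (b : 'I_n -> 'I_p -> R) DL :
  ThetaD E DL ->
  \prod_(i < n) dag_wishart_weight (V i) (b i) DL =
  dag_wishart_weight (\sum_i V i) (fun j => \sum_i b i j) DL.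
Proof.
move=> TDL; elim: n V b => [|n ih] V b.
  rewrite !big_ord0 -(dag_wishart_weight0 DL); congr dag_wishart_weight.
  by apply/funext => j; rewrite big_ord0.
rewrite !big_ord_recl ih dag_wishart_weightM//; congr dag_wishart_weight.
by apply/funext => j; rewrite big_ord_recl.
Qed.

Lemma in_LD_det (L : 'M[R]_p) : in_LD E L -> \det L = 1.
Proof. by move=> [Ltrig L1 _]; rewrite det_trig// big1. Qed.

Lemma det_diag_entries (D : 'M[R]_p) : is_diag_mx D -> \det D = \prod_i D i i.
Proof.
move=> /diag_mxP[d ->]; rewrite det_diag; apply: eq_bigr => i _.
by rewrite mxE eqxx mulr1n.
Qed.

Lemma sqrtr_prod n (F : 'I_n -> R) : (forall i, 0 <= F i) ->
  Num.sqrt (\prod_i F i) = \prod_i Num.sqrt (F i).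
Proof.
move=> F0; elim: n F F0 => [|n ih] F F0; first by rewrite !big_ord0 sqrtr1.
by rewrite !big_ord_recl sqrtrM// ih.
Qed.

(** Because det L = 1, the covariance matrix has determinant prod_i D_ii, which
    accounts for the shape parameters 1; its inverse is L D^-1 L^T, and
    y^T K y = tr (K y y^T). *)
Lemma mvnormal_pdf_weight DL (y : 'cV[R]_p) : ThetaD E DL ->
  mvnormal_pdf 0 (DL_covariance DL) y =
  (Num.sqrt ((2 * pi) ^+ p))^-1 * dag_wishart_weight (y *m y^T) (fun=> 1) DL.
Proof.
case: DL => D L [/= Ddiag D0 LL].
have detL := in_LD_det LL.
have uL : L \in unitmx by rewrite unitmxE detL unitr1.
have uD : D \in unitmx.
  rewrite unitmxE unitfE det_diag_entries// gt_eqF// prodr_gt0// => i _.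
rewrite /mvnormal_pdf /dag_wishart_weight/= /DL_covariance/= subr0.
have -> : invmx ((invmx L)^T *m D *m invmx L) = L *m invmx D *m L^T.
  apply: invmx_eq; rewrite -!mulmxA (mulmxA (invmx L)) mulVmx// mul1mx.
  by rewrite (mulmxA D) mulmxV// mul1mx -trmx_mul mulmxV// trmx1.
have -> : (y^T *m (L *m invmx D *m L^T) *m y) ord0 ord0 =
    \tr (L *m invmx D *m L^T *m (y *m y^T)).
  by rewrite -mxtrace_scalar -mulmxA mxtrace_mulC mulmxA.
rewrite !det_mulmx det_tr det_inv detL invr1 mul1r mulr1 det_diag_entries//.
rewrite sqrtrM; last by rewrite exprn_ge0// mulr_ge0// pi_ge0.
rewrite sqrtr_prod; last by move=> i; exact: ltW.
rewrite invfM -mulrA; congr (_ * _).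
rewrite mulrC; congr (_ * _).
rewrite -prodfV; apply: eq_bigr => i _.
by rewrite mulN1r powRN powR12_sqrt// ltW.
Qed.

End weight.

(** * Bounds for DAG-Wishart weights *)

Section pointwise_bounds.
Context {R : realType} {p : nat} (E : rel 'I_p).
Implicit Types (U V : 'M[R]_p) (a b : 'I_p -> R) (DL : 'M[R]_p * 'M[R]_p).

(** The exponential of - c / t beats every negative power of t as t tends to 0.
    With r = t^(-n/2), the series of the exponential bounds r^2 by a multiple of
    exp (c / t), and r <= 1 + r^2. *)
Lemma expR_powR_bound (c : R) n : 0 < c -> (0 < n)%N ->
  exists C, forall t, 0 < t -> expR (- (c / t)) * t `^ (- n%:R / 2) <= C.
Proof.
case: n => // n c0 _; exists (1 + (n.+1)`!%:R / c ^+ n.+1) => t t0.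
set r := t `^ _; have r0 : 0 <= r by exact: powR_ge0.
have r2 : r * r = (t^-1) ^+ n.+1.
  rewrite -powRD; last by rewrite (gt_eqF t0) implybT.
  have -> : - n.+1%:R / 2 + - n.+1%:R / 2 = - n.+1%:R :> R by field.
  by rewrite powRN powR_mulrn ?exprVn ?(ltW t0).
have s0 : 0 <= t^-1 by rewrite invr_ge0 ltW.
have := expR_ge1Dxn n (mulr_ge0 (ltW c0) s0).
set e := expR _ => eE.
have -> : expR (- (c / t)) = e^-1 by rewrite expRN.
have e0 : 0 < e by exact: expR_gt0.
rewrite mulrC ler_pdivrMr//.
have cn0 : 0 < c ^+ n.+1 by exact: exprn_gt0.
have f0 : 0 < (n.+1)`!%:R :> R by rewrite ltr0n fact_gt0.
have sE : r * r <= (n.+1)`!%:R / c ^+ n.+1 * e.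
  rewrite mulrAC ler_pdivlMr// r2 mulrC -exprMn -ler_pdivrMl// mulrC.
  by rewrite (le_trans _ eE)// lerDr.
rewrite mulrDl mul1r.
have e1 : 1 <= e.
  rewrite (le_trans _ eE)// lerDl mulr_ge0// ?invr_ge0 ?ler0n//.
  by rewrite exprn_ge0// mulr_ge0// ltW.
by have := sqr_ge0 (r - 1); rewrite expr2; nra.
Qed.

Lemma quadratic_form_col (L V : 'M[R]_p) k :
  (L^T *m V *m L) k k = ((col k L)^T *m V *m col k L) ord0 ord0.
Proof.
rewrite !mxE; apply: eq_bigr => j _; rewrite !mxE; congr (_ * _).
by apply: eq_bigr => i _; rewrite !mxE.
Qed.

(** The weight splits into a product over k of factors
    exp (- q_k / (4 D_kk)) D_kk^(-n/2), where q_k = (L^T U L)_kk is the value of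
    the form of U at the k-th column of L.  That column has k-th entry 1, so q_k
    has a positive lower bound that does not depend on (D, L). *)
Lemma dag_wishart_weight_bounded U n : posdefmx U -> (0 < n)%N ->
  exists C, forall DL, ThetaD E DL ->
    dag_wishart_weight (2^-1 *: U) (fun=> n%:R) DL <= C.
Proof.
move=> posU n0.
have bnd k : exists C, forall DL, ThetaD E DL ->
    expR (- ((DL.1 k k)^-1 * (DL.2^T *m (2^-1 *: U) *m DL.2) k k / 2)) *
    DL.1 k k `^ (- n%:R / 2) <= C.
  have [c c0 cU] := posdefmx_coord_bound k posU.
  have c40 : 0 < c / 4 by rewrite divr_gt0.
  have [C HC] := expR_powR_bound c40 n0.
  exists C => -[D L] [/= _ D0 [_ L1 _]].
  apply: le_trans (HC _ (D0 k)); rewrite ler_wpM2r ?powR_ge0// ler_expR lerN2.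
  rewrite /= -scalemxAr -scalemxAl mxE quadratic_form_col.
  have := cU (col k L); rewrite mxE L1 => /(_ erefl).
  set q : R := ((col k L)^T *m U *m col k L) ord0 ord0 => cq.
  have : 0 <= (D k k)^-1 * (q - c) by rewrite mulr_ge0 ?invr_ge0 ?subr_ge0// ltW.
  lra.
have [C HC] := choice bnd.
exists (\prod_k C k) => DL TDL.
have [Ddiag D0 _] := TDL.
rewrite /dag_wishart_weight mxtrace_quadratic_form//.
rewrite mulNr mulr_suml -sumrN expR_sum -big_split/=.
apply: ler_prod => k _; rewrite mulr_ge0 ?expR_ge0 ?powR_ge0//=.
exact: HC.
Qed.

(** One half of U controls the n new powers of the D_kk, the other half is kept
    for integrability. *)
Lemma dag_wishart_weight_shift U a n : posdefmx U -> (0 < n)%N ->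
  exists C, forall DL, ThetaD E DL ->
    dag_wishart_weight U (fun i => n%:R + a i) DL <=
    C * dag_wishart_weight (2^-1 *: U) a DL.
Proof.
move=> posU n0; have [C HC] := dag_wishart_weight_bounded posU n0.
exists C => DL TDL.
have -> : U = 2^-1 *: U + 2^-1 *: U.
  by rewrite -scalerDl (_ : 2^-1 + 2^-1 = 1 :> R) ?scale1r//; field.
rewrite -(dag_wishart_weightM _ _ (fun=> n%:R) a TDL) (_ : 2^-1 *: U + _ = U).
  rewrite ler_wpM2r ?HC// ltW//; exact: (dag_wishart_weight_gt0 _ _ TDL).
by rewrite -scalerDl (_ : 2^-1 + 2^-1 = 1 :> R) ?scale1r//; field.
Qed.

(** Halving U amounts to doubling D in the exponent. *)
Lemma dag_wishart_weight_half U a DL : ThetaD E DL ->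
  dag_wishart_weight (2^-1 *: U) a DL =
  \prod_(i < p) 2 `^ (a i / 2) * dag_wishart_weight U a (2 *: DL.1, DL.2).
Proof.
move: DL => [D L] [/= Ddiag D0 _]; rewrite /dag_wishart_weight/=.
rewrite !mxtrace_quadratic_form//; last 2 first.
- by apply/is_diag_mxP => i j ij; rewrite mxE (is_diag_mxP Ddiag _ _ ij) mulr0.
- by move=> i; rewrite mxE mulr_gt0.
rewrite mulrCA -big_split/=; congr (expR (- _ / 2) * _).
  apply: eq_bigr => k _; rewrite -scalemxAr -scalemxAl !mxE invfM.
  by rewrite mulrCA mulrA.
apply: eq_bigr => i _; rewrite mxE powRM ?ltW// mulrA -powRD ?pnatr_eq0 ?implybT//.
by rewrite -mulrDl subrr mul0r powRr0 mul1r.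
Qed.

Lemma dag_wishart_weight_antitone U a n (y : 'I_n -> 'cV[R]_p) DL : ThetaD E DL ->
  dag_wishart_weight (\sum_i y i *m (y i)^T + U) a DL <= dag_wishart_weight U a DL.
Proof.
move=> [Ddiag D0 _]; rewrite /dag_wishart_weight ler_wpM2r ?prodr_ge0//.
  by move=> i _; exact: powR_ge0.
rewrite ler_expR ler_pM2r ?invr_gt0// lerN2 mulmxDr linearD/= lerDr.
rewrite mulmx_sumr linear_sum/= sumr_ge0// => i _.
rewrite mxtrace_quadratic_form// sumr_ge0// => k _.
rewrite mulr_ge0 ?invr_ge0 ?(ltW (D0 k))//.
have -> : DL.2^T *m (y i *m (y i)^T) *m DL.2 = (DL.2^T *m y i) *m (DL.2^T *m y i)^T.
  by rewrite trmx_mul trmxK !mulmxA.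
by rewrite mxE big_ord1 [(_^T) _ _]mxE -expr2 sqr_ge0.
Qed.

End pointwise_bounds.

(** * Measurability and mass of the weights *)

Section measurability.
Context {R : realType} {p : nat} (E : rel 'I_p).

(** Membership in Theta_D is a condition on each pair of entries (D_ij, L_ij)
    separately, hence a finite intersection of cylinders. *)
Lemma measurable_ThetaD : measurable (ThetaD E : set ('M[R]_p * 'M[R]_p)).
Proof.
pose BD (ij : 'I_p * 'I_p) : set R :=
  if ij.1 == ij.2 then `]0, +oo[%classic else [set 0].
pose BL (ij : 'I_p * 'I_p) : set R :=
  if ij.1 == ij.2 then [set 1]
  else if (ij.1 < ij.2)%N || (ij.1 \notin pa E ij.2) then [set 0] else setT.
have -> : ThetaD E = \bigcap_(ij in [set: ('I_p * 'I_p)%type])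
    ((fun DL : 'M[R]_p * 'M[R]_p => DL.1 ij.1 ij.2) @^-1` BD ij `&`
     (fun DL : 'M[R]_p * 'M[R]_p => DL.2 ij.1 ij.2) @^-1` BL ij).
  apply/seteqP; split => [[D L] [/= /is_diag_mxP Ddiag D0 [/is_trig_mxP Ltrig L1 Lpa]]|].
    move=> [i j] _; split; rewrite /= /BD /BL/=.
      have [->|ij] := eqVneq i j; first by rewrite /= in_itv/= andbT.
      exact: Ddiag.
    have [->|ij] := eqVneq i j; first exact: L1.
    case: ifPn => [/orP[/Ltrig|/(Lpa _ _ ij)]|]//.
  move=> [D L] /= H; split => /=.
  - apply/is_diag_mxP => i j ij; have [+ _] := H (i, j) I.
    by rewrite /BD/= ifN.
  - move=> i; have [+ _] := H (i, i) I.
    by rewrite /BD/= eqxx/= in_itv/= andbT.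
  - split.
    + apply/is_trig_mxP => i j ij; have [_] := H (i, j) I.
      by rewrite /BL/= ifN ?ij// neq_ltn ij.
    + move=> i; have [_] := H (i, i) I.
      by rewrite /BL/= eqxx.
    + move=> i j ij ipa; have [_] := H (i, j) I.
      by rewrite /BL/= (negbTE ij) ipa orbT.
apply: fin_bigcap_measurable => [|[i j] _]; first exact: finite_finset.
apply: measurableI.
- rewrite -[X in measurable X]setTI.
  apply: (measurableT_comp (measurable_mx_entry i j) measurable_fst) => //.
  by rewrite /BD; case: ifP.
- rewrite -[X in measurable X]setTI.
  apply: (measurableT_comp (measurable_mx_entry i j) measurable_snd) => //.
  by rewrite /BL; case: ifP => // _; case: ifP.
Qed.

Lemma measurable_diag_weight d (X : measurableType d) (V : X -> 'M[R]_p)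
    (a : 'I_p -> R) (DL : X -> 'M[R]_p * 'M[R]_p) :
  (forall i j, measurable_fun setT (fun x => V x i j)) -> measurable_fun setT DL ->
  measurable_fun setT (fun x => diag_weight (V x) a (DL x)).
Proof.
move=> mV mDL.
have mD i j : measurable_fun setT (fun x => (DL x).1 i j).
  exact: (measurableT_comp (measurable_mx_entry i j)
    (measurableT_comp measurable_fst mDL)).
have mL i j : measurable_fun setT (fun x => (DL x).2 i j).
  exact: (measurableT_comp (measurable_mx_entry i j)
    (measurableT_comp measurable_snd mDL)).
apply: measurable_funM; last first.
  apply: measurable_prod => i _.
  exact: (measurableT_comp (@measurable_powR R _) (mD i i)).
apply: measurableT_comp => //; apply: measurable_funM => //.
apply: measurableT_comp => //; apply: measurable_sum => k.
apply: measurable_funM; first exact: (measurableT_comp (@measurable_powR R _) (mD k k)).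
under eq_fun do rewrite mxE; apply: measurable_sum => j.
apply: measurable_funM => //.
under eq_fun do rewrite mxE; apply: measurable_sum => i.
apply: measurable_funM => //.
by under eq_fun do rewrite mxE; exact: mL.
Qed.

End measurability.

Section mass.
Context {R : realType} {p : nat} (E : rel 'I_p).
Implicit Types (U V : 'M[R]_p) (a b : 'I_p -> R) (DL : 'M[R]_p * 'M[R]_p).
Local Open Scope ereal_scope.

Local Notation phi := (@DL_of_coord R p E).
Local Notation leb := (lebesgue_cV #|dag_coord E|).

(** The weight, extended by 0 outside Theta_D: integrals over Theta_D become
    integrals over the whole space of a function that is measurable jointly in
    the matrix V and in (D, L). *)
Definition ThetaD_weight V a DL : R :=
  diag_weight V a DL * \1_(ThetaD E) DL.

Lemma ThetaD_weight_ge0 V a DL : (0 <= ThetaD_weight V a DL)%R.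
Proof. by rewrite mulr_ge0// diag_weight_ge0. Qed.

Lemma ThetaD_weightE V a DL : ThetaD E DL ->
  ThetaD_weight V a DL = dag_wishart_weight V a DL.
Proof.
move=> TDL; rewrite (dag_wishart_weightE _ _ TDL) /ThetaD_weight indicE.
by rewrite mem_set// mulr1.
Qed.

Lemma measurable_ThetaD_weight d (X : measurableType d) (V : X -> 'M[R]_p)
    a (DL : X -> 'M[R]_p * 'M[R]_p) :
  (forall i j, measurable_fun setT (fun x => V x i j)) -> measurable_fun setT DL ->
  measurable_fun setT (fun x => ThetaD_weight (V x) a (DL x)).
Proof.
move=> mV mDL; apply: measurable_funM; first exact: measurable_diag_weight.
exact: (measurableT_comp (measurable_indic (measurable_ThetaD E)) mDL).
Qed.

Lemma measurable_ThetaD_weight1 V a : measurable_fun setT (ThetaD_weight V a).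
Proof.
by apply: (@measurable_ThetaD_weight _ _ (fun=> V) a id) => // i j; exact: measurable_cst.
Qed.

Lemma integral_ThetaD_weight
    (mu : {measure set ('M[R]_p * 'M[R]_p)%type -> \bar R}) V a A :
  \int[mu]_(DL in A `&` ThetaD E) (dag_wishart_weight V a DL)%:E =
  \int[mu]_(DL in A) (ThetaD_weight V a DL)%:E.
Proof.
rewrite integral_mkcond [RHS]integral_mkcond; apply: eq_integral => DL _.
rewrite !patchE in_setI; case: ifPn => [/andP[-> TDL]|].
  by rewrite ThetaD_weightE//; exact/set_mem.
rewrite negb_and; case: ifPn => //= _ TDL.
by rewrite /ThetaD_weight indicE (negbTE TDL) mulr0.
Qed.

Lemma dag_wishart_massE V a A : measurable A ->
  dag_wishart_mass E V a A = \int[leb]_(x in phi @^-1` A) (ThetaD_weight V a (phi x))%:E.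
Proof.
move=> mA; rewrite /dag_wishart_mass integral_ThetaD_weight.
rewrite ge0_integral_pushforward//.
- exact: measurable_DL_of_coord.
- by apply: measurable_funTS; apply/measurable_EFinP; exact: measurable_ThetaD_weight1.
- by move=> DL _; rewrite lee_fin ThetaD_weight_ge0.
Qed.

Lemma dag_wishart_massTE V a :
  dag_wishart_mass E V a setT = \int[leb]_x (ThetaD_weight V a (phi x))%:E.
Proof. by rewrite (dag_wishart_massE _ _ measurableT) preimage_setT. Qed.

Lemma dag_wishart_mass_ge0 V a A : 0 <= dag_wishart_mass E V a A.
Proof.
rewrite /dag_wishart_mass integral_ThetaD_weight.
by apply: integral_ge0 => DL _; rewrite lee_fin ThetaD_weight_ge0.
Qed.

Let double_D DL : 'M[R]_p * 'M[R]_p := ((2 *: DL.1)%R, DL.2).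

(* The dilation of the coordinate space that induces D -> 2 D. *)
Let coord_scale (i : 'I_#|dag_coord E|) : R :=
  if enum_val i is inl _ then 2 else 1%R.

Let double_coord (x : 'cV[R]_#|dag_coord E|) :
  phi (\col_i (coord_scale i * x i ord0)%R) = double_D (phi x).
Proof.
congr pair; apply/matrixP => i j; rewrite !mxE /=.
  by rewrite /coord_scale enum_rankK/= mulrnAr.
by case: insub => // e; rewrite mxE /coord_scale enum_rankK mul1r.
Qed.

Let ThetaD_double DL : ThetaD E (double_D DL) <-> ThetaD E DL.
Proof.
move: DL => [D L]; split => -[/= /is_diag_mxP Ddiag D0 LL]; split => //=.
- apply/is_diag_mxP => i j ij; have := Ddiag i j ij.
  by rewrite mxE => /eqP; rewrite mulf_eq0 pnatr_eq0/= => /eqP.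
- by move=> i; have := D0 i; rewrite mxE pmulr_rgt0.
- by apply/is_diag_mxP => i j ij; rewrite mxE Ddiag// mulr0.
- by move=> i; rewrite mxE mulr_gt0.
Qed.

(** The substitution D -> 2 D, which leaves L alone and preserves Theta_D. *)
Lemma dag_wishart_mass_half U a : dag_wishart_mass E U a setT < +oo ->
  dag_wishart_mass E (2^-1 *: U) a setT < +oo.
Proof.
rewrite !dag_wishart_massTE => Uoo.
have wE x : (ThetaD_weight (2^-1 *: U) a (phi x))%:E =
    (\prod_(i < p) 2 `^ (a i / 2))%:E *
    (ThetaD_weight U a (phi (\col_i (coord_scale i * x i ord0)%R)))%:E.
  rewrite -EFinM double_coord; congr EFin.
  have [Tx|Tx] := pselect (ThetaD E (phi x)).
    rewrite !ThetaD_weightE//; last exact/ThetaD_double.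
    exact: (dag_wishart_weight_half _ _ Tx).
  have dTx : ~ ThetaD E (double_D (phi x)) by move=> /ThetaD_double.
  by rewrite /ThetaD_weight !indicE (memNset Tx) (memNset dTx) !mulr0.
under eq_integral do rewrite wE.
have mU : measurable_fun setT (fun x => (ThetaD_weight U a (phi x))%:E).
  apply/measurable_EFinP; apply: (measurableT_comp (measurable_ThetaD_weight1 U a)).
  exact: measurable_DL_of_coord.
rewrite ge0_integralZl//; last 3 first.
- apply: (measurableT_comp mU); apply: measurable_fun_mx => i j.
  under eq_fun do rewrite mxE.
  by apply: measurable_funM => //; exact: measurable_mx_entry.
- by move=> x _; rewrite lee_fin ThetaD_weight_ge0.
- by rewrite lee_fin prodr_ge0// => i _; exact: powR_ge0.
rewrite (ge0_integral_lebesgue_cV_scale _ mU); last 2 first.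
- by move=> i; rewrite /coord_scale; case: (enum_val i).
- by move=> x; rewrite lee_fin ThetaD_weight_ge0.
rewrite muleA -EFinM lte_mul_pinfty// ?lee_fin//.
rewrite mulr_ge0 ?invr_ge0 ?prodr_ge0// => i _.
by rewrite /coord_scale; case: (enum_val i).
Qed.

(** Finiteness at every sample y; a joint density argument would only give it at
    almost every y. *)
Lemma dag_wishart_mass_update_lty U a n m (y : 'I_m -> 'cV[R]_p) :
  posdefmx U -> (0 < n)%N -> dag_wishart_mass E U a setT < +oo ->
  dag_wishart_mass E (\sum_i y i *m (y i)^T + U) (fun i => n%:R + a i)%R setT < +oo.
Proof.
move=> posU n0 /dag_wishart_mass_half; rewrite !dag_wishart_massTE => Uoo.
have [C HC] := dag_wishart_weight_shift E a posU n0.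
have mw V b : measurable_fun setT (fun x => (ThetaD_weight V b (phi x))%:E).
  apply/measurable_EFinP; apply: (measurableT_comp (measurable_ThetaD_weight1 V b)).
  exact: measurable_DL_of_coord.
apply: (@le_lt_trans _ _ (\int[leb]_x
    (`|C|%:E * (ThetaD_weight (2^-1 *: U) a (phi x))%:E))).
  apply: ge0_le_integral => //.
  - by move=> x _; rewrite lee_fin ThetaD_weight_ge0.
  - by apply: emeasurable_funM => //; exact: mw.
  - move=> x _; rewrite -EFinM lee_fin.
    have [Tx|Tx] := pselect (ThetaD E (phi x)); last first.
      by rewrite /ThetaD_weight indicE memNset// !mulr0.
    rewrite !ThetaD_weightE//; apply: le_trans (dag_wishart_weight_antitone _ _ _ Tx) _.
    apply: le_trans (HC _ Tx) _; rewrite ler_wpM2r ?ler_norm// ltW//.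
    exact: (dag_wishart_weight_gt0 _ _ Tx).
rewrite ge0_integralZl//.
- by rewrite lte_mul_pinfty// lee_fin.
- by move=> x _; rewrite lee_fin ThetaD_weight_ge0.
Qed.

(** If the mass vanished for one pair of parameters then Theta_D would be a null
    set, as the weight is positive there, and it would vanish for all. *)
Lemma dag_wishart_mass_gt0 U a V b : 0 < dag_wishart_mass E U a setT ->
  0 < dag_wishart_mass E V b setT.
Proof.
rewrite !lt0e !dag_wishart_mass_ge0 !andbT; apply: contra => /eqP V0; apply/eqP.
move: V0; rewrite !dag_wishart_massTE => V0.
have mw W c : measurable_fun setT (fun x => (ThetaD_weight W c (phi x))%:E).
  apply/measurable_EFinP; apply: (measurableT_comp (measurable_ThetaD_weight1 W c)).
  exact: measurable_DL_of_coord.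
have : ae_eq leb setT (fun x => (ThetaD_weight V b (phi x))%:E) (cst 0).
  apply/(ae_eq_integral_abs _ measurableT) => //.
  by under eq_integral do rewrite gee0_abs ?lee_fin ?ThetaD_weight_ge0//.
move=> aeV; rewrite -[RHS](integral0 leb setT); apply: ae_eq_integral => //.
apply: filterS aeV => x /(_ I) [] V0x _ /=; congr EFin.
have [Tx|Tx] := pselect (ThetaD E (phi x)); last first.
  by rewrite /ThetaD_weight indicE memNset// !mulr0.
by have := dag_wishart_weight_gt0 V b Tx; rewrite -ThetaD_weightE// V0x ltxx.
Qed.

End mass.

(** * Likelihood and posterior *)

Section likelihood.
Context {R : realType} {p : nat} (E : rel 'I_p) (n : nat).
Local Open Scope ereal_scope.

(** For n > 0, this is n times the empirical covariance matrix. *)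
Definition scatter (y : n.-tuple 'cV[R]_p) : 'M[R]_p :=
  (\sum_i tnth y i *m (tnth y i)^T)%R.

Definition mvnormal_const : R := (Num.sqrt ((2 * pi) ^+ p))^-1%R.

Lemma mvnormal_const_gt0 : (0 < mvnormal_const)%R.
Proof. by rewrite invr_gt0 sqrtr_gt0 exprn_gt0// mulr_gt0// pi_gt0. Qed.

Lemma measurable_scatter_entry i j :
  measurable_fun setT (fun y : n.-tuple 'cV[R]_p => scatter y i j).
Proof.
under eq_fun do rewrite summxE.
apply: measurable_sum => k.
under eq_fun do rewrite mxE big_ord1 [(_^T)%R _ _]mxE.
by apply: measurable_funM;
  exact: (measurableT_comp (measurable_mx_entry _ _) (@measurable_tnth _ _ _ k)).
Qed.

Lemma measurable_outer_entry i j :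
  measurable_fun setT (fun y : 'cV[R]_p => (y *m y^T) i j).
Proof.
under eq_fun do rewrite mxE big_ord1 [(_^T)%R _ _]mxE.
by apply: measurable_funM; exact: measurable_mx_entry.
Qed.

(** The likelihood of a sample is a single weight, with matrix [scatter y] and
    shape parameters n. *)
Lemma mvnormal_likelihood DL (B : 'I_n -> set 'cV[R]_p) : ThetaD E DL ->
  (forall i, measurable (B i)) ->
  \prod_(i < n) mvnormal 0 (DL_covariance DL) (B i) =
  \int[power_measure (lebesgue_cV p) n]_(y in box B)
    (mvnormal_const ^+ n * ThetaD_weight E (scatter y) (fun=> n%:R) DL)%:E.
Proof.
move=> TDL mB.
pose h i (y : 'cV[R]_p) : \bar R :=
  (mvnormal_const * ThetaD_weight E (y *m y^T) (fun=> 1%R) DL * \1_(B i) y)%:E.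
have h0 i y : 0 <= h i y.
  by rewrite lee_fin mulr_ge0// mulr_ge0 ?ThetaD_weight_ge0// ltW// mvnormal_const_gt0.
have mh i : measurable_fun setT (h i).
  apply/measurable_EFinP; apply: measurable_funM; last exact: measurable_indic.
  apply: measurable_funM => //.
  by apply: measurable_ThetaD_weight => //; exact: measurable_outer_entry.
transitivity (\prod_(i < n) \int[lebesgue_cV p]_y h i y).
  apply: eq_bigr => i _; rewrite /mvnormal integral_mkcond.
  apply: eq_integral => y _; rewrite patchE /h indicE.
  case: ifPn => _; last by rewrite mulr0.
  by rewrite mulr1 (mvnormal_pdf_weight _ TDL) ThetaD_weightE.
rewrite -ge0_integral_power_measure_prod// [RHS]integral_mkcond.
apply: eq_integral => y _; rewrite patchE prodEFin.
case: ifPn => yB.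
  have yBi i : tnth y i \in B i by apply/mem_set; exact: (set_mem yB i).
  congr EFin; transitivity (\prod_(i < n) (mvnormal_const *
      dag_wishart_weight (tnth y i *m (tnth y i)^T) (fun=> 1) DL))%R.
    by apply: eq_bigr => i _; rewrite indicE yBi mulr1 ThetaD_weightE.
  rewrite big_split/= prodr_const card_ord (dag_wishart_weight_sum _ _ TDL).
  rewrite ThetaD_weightE//; congr (_ * dag_wishart_weight _ _ _)%R.
  by apply/funext => j; rewrite sumr_const card_ord.
have [i yBi] : exists i, ~ B i (tnth y i).
  by apply/existsNP => yB'; move/negP : yB; apply; exact/mem_set.
by rewrite (bigD1 i)//= indicE (memNset yBi) mulr0 mul0r.
Qed.

End likelihood.

Section posterior.
Context {R : realType} {p n : nat} (E : rel 'I_p) (U : 'M[R]_p) (alpha : 'I_p -> R).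
Local Open Scope ereal_scope.

Local Notation phi := (@DL_of_coord R p E).
Local Notation leb := (lebesgue_cV #|dag_coord E|).
Local Notation nu := (power_measure (lebesgue_cV p) n).
Local Notation c := (@mvnormal_const R p).

(** With the conventions 0^-1 = 0 and fine +oo = 0, normalising a null or
    infinite mass gives total mass 0, so a total mass 1 excludes both. *)
Lemma dag_wishart_normalized : dag_wishart E U alpha setT = 1 ->
  0 < dag_wishart_mass E U alpha setT < +oo.
Proof.
rewrite /dag_wishart; have := dag_wishart_mass_ge0 E U alpha setT.
case: dag_wishart_mass => [r| |]//=.
  rewrite !lee_fin lte_fin ltry andbT le0r => /orP[/eqP->|//].
  by rewrite mul0e => -[] /esym/eqP; rewrite oner_eq0.
by rewrite invr0 mule0 => _ -[] /esym/eqP; rewrite oner_eq0.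
Qed.

Lemma dag_wishart_ThetaDC : dag_wishart E U alpha (~` ThetaD E) = 0.
Proof.
by rewrite /dag_wishart /dag_wishart_mass setICl integral_set0 mul0e.
Qed.

Let Z : R := fine (dag_wishart_mass E U alpha setT).

(** The prior density times the likelihood, already merged into a single weight
    by conjugacy; Z is the normalising constant of the prior. *)
Definition joint_density (xy : 'cV[R]_#|dag_coord E| * n.-tuple 'cV[R]_p) : \bar R :=
  (c ^+ n / Z * ThetaD_weight E (scatter xy.2 + U)%R
     (fun i => n%:R + alpha i)%R (DL_of_coord xy.1))%:E.

Hypothesis prior1 : dag_wishart E U alpha setT = 1.

Let Z0 : (0 < Z)%R.
Proof. exact: fine_gt0 (dag_wishart_normalized prior1). Qed.

Let k0 : (0 < c ^+ n / Z)%R.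
Proof. by rewrite divr_gt0// exprn_gt0// mvnormal_const_gt0. Qed.

Lemma measurable_joint_density : measurable_fun setT joint_density.
Proof.
apply/measurable_EFinP; apply: measurable_funM => //.
apply: measurable_ThetaD_weight; last first.
  exact: (measurableT_comp (@measurable_DL_of_coord _ _ E) measurable_fst).
move=> i j; under eq_fun do rewrite mxE.
apply: measurable_funD => //.
exact: (measurableT_comp (measurable_scatter_entry i j) measurable_snd).
Qed.

Lemma joint_density_ge0 xy : 0 <= joint_density xy.
Proof. by rewrite lee_fin mulr_ge0 ?ThetaD_weight_ge0// ltW. Qed.

Lemma integral_joint_density A y : measurable A ->
  \int[leb]_(x in phi @^-1` A) joint_density (x, y) =
  (c ^+ n / Z)%:E *
  dag_wishart_mass E (scatter y + U) (fun i => n%:R + alpha i)%R A.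
Proof.
move=> mA; rewrite dag_wishart_massE//.
rewrite -ge0_integralZl//.
- by rewrite -[X in measurable X]setTI; exact: measurable_DL_of_coord.
- apply: measurable_funTS; apply/measurable_EFinP.
  apply: (measurableT_comp (measurable_ThetaD_weight1 E _ _)).
  exact: measurable_DL_of_coord.
- by move=> x _; rewrite lee_fin ThetaD_weight_ge0.
- by rewrite lee_fin ltW.
Qed.

Context d (Omega : measurableType d) (P : probability Omega R).
Variables (DL : {RV P >-> ('M[R]_p * 'M[R]_p)%type})
  (Y : {RV P >-> n.-tuple 'cV[R]_p}).
Hypothesis prior : forall A, measurable A ->
  distribution P DL A = dag_wishart E U alpha A.
Hypothesis sample : iid_given DL Y (fun DL0 => mvnormal 0 (DL_covariance DL0)).

(** Conditioning on (D, L) gives the prior integral of the likelihood; its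
    integrand is only recognised on Theta_D, which carries the prior, so the
    event is first cut down to Theta_D.  The prior has a density with respect to
    the volume, and conjugacy identifies the product. *)
Lemma joint_law_rectangle A B : measurable A -> measurable_boxes B ->
  P (DL @^-1` A `&` Y @^-1` B) =
  \int[leb]_(x in phi @^-1` A)
    \int[nu]_(y in B) joint_density (x, y).
Proof.
move=> mA [Bs mBs <-].
have mT := measurable_ThetaD (R := R) E.
have mRV d' (T : measurableType d') (X : {RV P >-> T}) C :
    measurable C -> measurable (X @^-1` C).
  by move=> mC; rewrite -[X in measurable X]setTI; exact: measurable_funPT.
have mAT : measurable (A `&` ThetaD E) by exact: measurableI.
have mbox := measurable_box mBs.
(* The prior gives no mass to the complement of Theta_D. *)
have -> : P (DL @^-1` A `&` Y @^-1` box Bs) =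
    P (DL @^-1` (A `&` ThetaD E) `&` Y @^-1` box Bs).
  have mAB : measurable (DL @^-1` A `&` Y @^-1` box Bs).
    by apply: measurableI; exact: mRV.
  rewrite (measureDI P mAB (mRV _ _ DL _ mT)) [X in X + _](_ : _ = 0).
    by rewrite add0e preimage_setI setIAC.
  apply: (@subset_measure0 _ _ _ P _ (DL @^-1` (~` ThetaD E))).
  - by apply: measurableD => //; exact: mRV.
  - by apply: mRV; exact: measurableC.
  - by move=> w [_].
  - rewrite -[LHS]/(distribution P DL (~` ThetaD E)) prior; last exact: measurableC.
    exact: dag_wishart_ThetaDC.
rewrite [LHS](sample mAT mBs).
(* The conditional probability of the box given (D, L) in Theta_D, extended by 0
   to a measurable function on all pairs of matrices. *)
pose G (DL0 : 'M[R]_p * 'M[R]_p) := \int[nu]_(y in box Bs)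
    (c ^+ n * ThetaD_weight E (scatter y) (fun=> n%:R) DL0)%:E.
have mG : measurable_fun setT G.
  rewrite /G; under eq_fun do rewrite integral_mkcond.
  pose g (z : ('M[R]_p * 'M[R]_p) * n.-tuple 'cV[R]_p) : \bar R :=
    (c ^+ n * ThetaD_weight E (scatter z.2) (fun=> n%:R) z.1
     * \1_(box Bs) z.2)%:E.
  have -> : (fun DL0 => \int[nu]_y
    ((fun y => (c ^+ n *
        ThetaD_weight E (scatter y) (fun=> n%:R) DL0)%:E)
       \_ (box Bs)) y) = fubini_F nu g.
    apply/funext => DL0; apply: eq_integral => y _.
    by rewrite /g patchE/= indicE; case: ifPn => _; rewrite ?mulr1 ?mulr0.
  apply: measurable_fun_fubini_tonelli_F.
    apply/measurable_EFinP; apply: measurable_funM; last first.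
      exact: (measurableT_comp (measurable_indic mbox) measurable_snd).
    apply: measurable_funM => //.
    apply: measurable_ThetaD_weight => // i j.
    exact: (measurableT_comp (measurable_scatter_entry i j) measurable_snd).
  move=> z; rewrite lee_fin mulr_ge0// mulr_ge0 ?ThetaD_weight_ge0//.
  by rewrite exprn_ge0// ltW// mvnormal_const_gt0.
have G0 DL0 : 0 <= G DL0.
  apply: integral_ge0 => y _; rewrite lee_fin mulr_ge0 ?ThetaD_weight_ge0//.
  by rewrite exprn_ge0// ltW// mvnormal_const_gt0.
transitivity (\int[P]_(w in DL @^-1` (A `&` ThetaD E)) (G \o DL) w).
  apply: eq_integral => w /set_mem[_ TDL].
  by rewrite (mvnormal_likelihood TDL mBs).
rewrite -ge0_integral_pushforward//; last exact: measurable_funTS.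
rewrite (ge0_integral_density (lam := distribution P DL) (nu := @dag_volume R p E)
  (m := fun DL0 => Z^-1 * ThetaD_weight E U alpha DL0)%R); last 6 first.
- by apply: measurable_funM => //; exact: measurable_ThetaD_weight1.
- by move=> DL0; rewrite mulr_ge0 ?ThetaD_weight_ge0// invr_ge0 ltW.
- move=> C mC; rewrite [LHS](prior mC) /dag_wishart -/Z.
  rewrite /dag_wishart_mass integral_ThetaD_weight.
  rewrite muleC -ge0_integralZl//.
  + by apply: measurable_funTS; apply/measurable_EFinP; exact: measurable_ThetaD_weight1.
  + by move=> DL0 _; rewrite lee_fin ThetaD_weight_ge0.
  + by rewrite lee_fin invr_ge0 ltW.
- by [].
- exact: measurable_funTS.
- by move=> DL0 _; exact: G0.
rewrite ge0_integral_pushforward//; last 3 first.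
- exact: measurable_DL_of_coord.
- apply: measurable_funTS; apply: emeasurable_funM => //.
  apply/measurable_EFinP; apply: measurable_funM => //; exact: measurable_ThetaD_weight1.
- move=> DL0 _; rewrite mule_ge0// lee_fin mulr_ge0 ?ThetaD_weight_ge0//.
  by rewrite invr_ge0 ltW.
rewrite integral_mkcond [RHS]integral_mkcond; apply: eq_integral => x _.
rewrite !patchE preimage_setI in_setI; case: ifPn => /=; last first.
  rewrite negb_and; case: ifPn => //= _ xT.
  have {}xT : ~ ThetaD E (DL_of_coord x).
    by move=> Tx; move/negP : xT; apply; exact/mem_set.
  rewrite integral0_eq// => y _.
  by rewrite /joint_density/= /ThetaD_weight indicE (memNset xT) !mulr0.
move=> /andP[-> /set_mem xT]; rewrite /G -ge0_integralZr//; last 3 first.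
- apply: measurable_funTS; apply/measurable_EFinP; apply: measurable_funM => //.
  by apply: measurable_ThetaD_weight => //; exact: measurable_scatter_entry.
- move=> y _; rewrite lee_fin mulr_ge0 ?ThetaD_weight_ge0//.
  by rewrite exprn_ge0// ltW// mvnormal_const_gt0.
- by rewrite lee_fin mulr_ge0 ?ThetaD_weight_ge0// invr_ge0 ltW.
apply: eq_integral => y _; rewrite /joint_density -EFinM/=; congr EFin.
by rewrite mulrACA !ThetaD_weightE// (dag_wishart_weightM _ _ _ _ xT).
Qed.

End posterior.

Theorem proposition7p5 (R : realType) (p n : nat) (E : rel 'I_p)
    (U : 'M[R]_p) (alpha : 'I_p -> R)
    (d : measure_display) (Omega : measurableType d) (P : probability Omega R)
    (DL : {RV P >-> ('M[R]_p * 'M[R]_p)%type})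
    (Y : {RV P >-> n.-tuple 'cV[R]_p}) :
  (0 < n)%N ->
  parent_ordering E ->
  posdefmx U ->
  (forall i, #|pa E i|%:R + 2 < alpha i) ->
  (forall A, measurable A -> distribution P DL A = dag_wishart E U alpha A) ->
  iid_given DL Y (fun DL0 => mvnormal 0 (DL_covariance DL0)) ->
  exists2 posterior : R.-pker (n.-tuple 'cV[R]_p) ~> ('M[R]_p * 'M[R]_p)%type,
    forall y A, measurable A ->
      posterior y A = dag_wishart E (n%:R *: empirical_covariance y + U)
                                  (fun i => n%:R + alpha i) A
    & conditional_distribution DL Y posterior.
Proof.
move=> n0 _ posU _ prior sample.
have prior1 : (dag_wishart E U alpha setT = 1)%E.
  by rewrite -prior// /distribution/= /pushforward preimage_setT probability_setT.
have /andP[Z0 Zoo] := dag_wishart_normalized prior1.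
have mphi := @measurable_DL_of_coord R p E.
pose kappa := mvnormal_const (R := R) (p := p) ^+ n /
  fine (dag_wishart_mass E U alpha setT).
pose mass (y : n.-tuple 'cV[R]_p) :=
  dag_wishart_mass E (scatter y + U) (fun i => n%:R + alpha i) setT.
pose marginal (y : n.-tuple 'cV[R]_p) : \bar R :=
  (\int[lebesgue_cV #|dag_coord E|]_x joint_density U alpha (x, y))%E.
have kappa0 : 0 < kappa.
  by rewrite divr_gt0 ?exprn_gt0 ?mvnormal_const_gt0 ?fine_gt0 ?Z0.
have marginalE y : marginal y = (kappa%:E * mass y)%E.
  exact: (integral_joint_density prior1 y measurableT).
have mass_gt0 y : (0 < mass y)%E by exact: dag_wishart_mass_gt0 Z0.
have mass_lty y : (mass y < +oo)%E by exact: dag_wishart_mass_update_lty.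
have marginal_gt0 y : (0 < marginal y)%E.
  by rewrite marginalE mule_gt0.
have marginal_lty y : (marginal y < +oo)%E.
  by rewrite marginalE lte_mul_pinfty// lee_fin ltW.
have mf := measurable_joint_density (n := n) (E := E) U alpha.
have [k kE kY] := @bayes_formula _ _ _ _ _ _ _ _ _ _ _ _ _ mphi mf
  (joint_density_ge0 prior1) marginal_gt0 marginal_lty P DL Y _
  (measurable_tupleE _ n) (@setI_closed_boxes _ _ n) (@measurable_boxesT _ _ n)
  (joint_law_rectangle prior1 prior sample).
exists k; last exact: kY.
move=> y A mA; rewrite kE -/(marginal y) marginalE (integral_joint_density prior1 y mA).
have -> : n%:R *: empirical_covariance y = scatter y.
  by rewrite scalerA divff ?scale1r// pnatr_eq0 -lt0n.
apply: ratio_scale; first exact: kappa0.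
rewrite (ge0_fin_numE (ltW (mass_gt0 y))); exact: mass_lty.
Qed.
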